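(* Let $n\ge 3$ be an integer and let $\mathcal{Q}(n)$ be the $n$-Queens graph. 1. If $n$ is even, then $n-4$ is an eigenvalue of $\mathcal{Q}(n)$ with multiplicity at least $\frac{n-2}{2}$. 2. If $n$ is odd, then $n-4$ is an eigenvalue of $\mathcal{Q}(n)$ with multiplicity at least $\frac{n+1}{2}$.
   Context: The $n$-Queens graph $\mathcal{Q}(n)$ is the simple graph whose vertices are the $n^2$ squares $(i,j) \in \{1,\dots,n\}^2$ of an $n\times n$ chessboard ($i$ is the row, $j$ is the column), two distinct vertices being adjacent if and only if they lie in the same row, the same column, or the same diagonal; that is, distinct $(i,j)$ and $(p,q)$ are adjacent iff $i=p$, or $j=q$, or $i+j=p+q$, or $i-j=p-q$. The eigenvalues of $\mathcal{Q}(n)$ and their multiplicities are those of its (real symmetric) adjacency matrix. *)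

(* Defs.v *)
From HB Require Import structures.
From mathcomp Require Import all_boot all_order all_algebra.
From mathcomp Require Import reals.

Set Implicit Arguments.
Unset Strict Implicit.
Unset Printing Implicit Defensive.

Import Order.TTheory GRing.Theory Num.Theory.
Local Open Scope ring_scope.

(* Rows and columns are numbered from 0 instead of 1, which changes none of the
   four conditions.  The difference i - j is taken in int since subtraction
   on nat is truncated. *)
Definition queens_adj (n : nat) : rel ('I_n * 'I_n) :=
  fun u v =>
    (u != v) &&
    [|| u.1 == v.1,
        u.2 == v.2,
        (u.1 + u.2 == v.1 + v.2)%N
      | (u.1%:Z - u.2%:Z == v.1%:Z - v.2%:Z)].

Lemma queens_adj_sym (n : nat) : symmetric (@queens_adj n).
Proof.
move=> u v; rewrite /queens_adj eq_sym (eq_sym u.1) (eq_sym u.2).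
by rewrite (eq_sym (_ + _)%N) (eq_sym (_ - _)).
Qed.

Lemma queens_adj_irr (n : nat) : irreflexive (@queens_adj n).
Proof. by move=> u; rewrite /queens_adj eqxx. Qed.

Definition adjacency_mx (R : realType) (T : finType) (e : rel T) : 'M[R]_#|T| :=
  \matrix_(i, j) (e (enum_val i) (enum_val j))%:R.

(* Left eigenvectors, as in [eigenspace]; for the symmetric matrices considered
   here these are the transposes of the right ones, and the dimension of an
   eigenspace is also the multiplicity of the root of the characteristic
   polynomial. *)
Definition eigen_mult (R : realType) (m : nat) (A : 'M[R]_m) (a : R) : nat :=
  \rank (eigenspace A a).

(* Main.v *)
Require Import Defs.
From HB Require Import structures.
From mathcomp Require Import all_boot all_order all_algebra.
From mathcomp Require Import reals.
From mathcomp Require Import zify ring.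

(** For a function [f] on the board, let [R(v)], [C(v)], [D(v)], [S(v)] be its
    sums along the row, the column, the diagonal and the antidiagonal through
    the square [v].  Two distinct squares share at most one line, and [v] lies
    on all four of its lines, so the adjacency operator sends [f] to
    [R + C + D + S - 4 f] ([sum_queens_adj]).  Hence [f] is an eigenfunction for
    [n - 4] as soon as [R + C + D + S = n f].

    A first family of solutions is [f(i, j) = r(i) - r(j)], with [r] invariant
    under the reversal [i |-> n - 1 - i] ([row_col_diff_eigen]).  The row and
    column sums then add up to [n f], while [f] changes sign under the
    reflections in the two main diagonals of the board.  One of them preserves
    every diagonal and the other every antidiagonal, so [D = S = 0].  The [r]
    form a space of dimension [ceil(n / 2)], and only the constants give
    [f = 0]: this yields [ceil(n / 2) - 1] independent eigenfunctions.

    For odd [n] there is one more, the indicator of the main diagonal minus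
    that of the main antidiagonal ([diag_cross_eigen]).  It is symmetric in
    [i] and [j] whereas the former are antisymmetric.

    Independence is witnessed by squares on which these functions take the
    values of a dual basis ([eigen_mult_ge]). *)

Set Implicit Arguments.
Unset Strict Implicit.
Unset Printing Implicit Defensive.

Import Order.TTheory GRing.Theory Num.Theory.
Local Open Scope ring_scope.

(** * Lower bounds on multiplicities *)

(** The points [p] give a right inverse to the matrix whose rows are the
    eigenfunctions [f s], which makes these rows free. *)
Lemma eigen_mult_ge (R : realType) (T I : finType) (e : rel T) (a : R)
    (f : I -> T -> R) (p : I -> T) :
  (forall s v, \sum_u f s u * (e u v)%:R = a * f s v) ->
  (forall s t, f s (p t) = (s == t)%:R) ->
  (#|I| <= eigen_mult (adjacency_mx R e) a)%N.
Proof.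
move=> eig dual.
pose V : 'M[R]_(#|I|, #|T|) := \matrix_(i, j) f (enum_val i) (enum_val j).
pose E : 'M[R]_(#|T|, #|I|) := \matrix_(j, i) (enum_val j == p (enum_val i))%:R.
have VE : V *m E = 1%:M.
  apply/matrixP => s t; rewrite !mxE.
  rewrite (bigD1 (enum_rank (p (enum_val t)))) //= !mxE enum_rankK eqxx mulr1.
  rewrite big1 ?addr0; first by rewrite dual (inj_eq enum_val_inj).
  move=> j; rewrite !mxE -(inj_eq enum_val_inj) enum_rankK => /negbTE ->.
  by rewrite mulr0.
have freeV : row_free V by apply/row_freeP; exists E.
have sVA : (V <= eigenspace (adjacency_mx R e) a)%MS.
  apply/eigenspaceP/matrixP => s v; rewrite !mxE -eig.
  rewrite [RHS](reindex_onto enum_val enum_rank) /=; last first.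
    by move=> u _; rewrite enum_rankK.
  by apply: eq_big => [u|u _]; rewrite ?enum_valK ?eqxx // !mxE.
by rewrite -[leqLHS](eqP freeV) mxrankS.
Qed.

Lemma eigen_mult_gt0 (R : realType) (m : nat) (A : 'M[R]_m) (a : R) :
  (0 < eigen_mult A a)%N -> eigenvalue A a.
Proof. by rewrite /eigen_mult lt0n mxrank_eq0. Qed.

(** * Sums along lines of the board *)

(** An involution of a line that negates [f] makes the sum over it vanish. *)
Lemma sum_odd_involution (R : numDomainType) (T : finType) (P : pred T)
    (f : T -> R) (h : T -> T) :
  involutive h -> (forall u, P (h u) = P u) -> (forall u, f (h u) = - f u) ->
  \sum_(u | P u) f u = 0.
Proof.
move=> hK Ph fh; apply/eqP; rewrite -eqNr; apply/eqP.
rewrite [RHS](reindex_inj (inv_inj hK)) -sumrN.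
by apply: eq_big => u; rewrite ?Ph ?fh.
Qed.

Section Board.
Variables (R : realType) (n : nat).
Implicit Types (f : 'I_n * 'I_n -> R) (u v : 'I_n * 'I_n).

Definition row_sum f v := \sum_(u | u.1 == v.1) f u.
Definition col_sum f v := \sum_(u | u.2 == v.2) f u.
Definition diag_sum f v :=
  \sum_(u : 'I_n * 'I_n | u.1%:Z - u.2%:Z == v.1%:Z - v.2%:Z) f u.
Definition antidiag_sum f v :=
  \sum_(u : 'I_n * 'I_n | (u.1 + u.2 == v.1 + v.2)%N) f u.

(** The four lines through [v] cover [v] itself four times and every other
    square at most once. *)
Lemma sum_queens_adj f v :
  \sum_u f u * (queens_adj u v)%:R =
  row_sum f v + col_sum f v + diag_sum f v + antidiag_sum f v - 4 * f v.
Proof.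
have -> : 4 * f v = \sum_(u | u == v) 4 * f u by rewrite big_pred1_eq.
have mk P F : \sum_(u : 'I_n * 'I_n | P u) F u = \sum_u (P u)%:R * F u :> R.
  rewrite big_mkcond; apply: eq_bigr => u _.
  by case: (P u); rewrite ?mul1r ?mul0r.
rewrite /row_sum /col_sum /diag_sum /antidiag_sum.
rewrite !(mk (fun _ => _ == _)) -!big_split -sumrB /=.
apply: eq_bigr => u _; rewrite /queens_adj.
have [->|neq_uv] /= := eqVneq u v; first by rewrite !eqxx /=; ring.
have {neq_uv} : ~ (u.1 = v.1 :> nat /\ u.2 = v.2 :> nat).
  case: u v neq_uv => [i j] [p q] /= + [/val_inj ip /val_inj jq].
  by rewrite ip jq eqxx.
rewrite -!val_eqE /=.
case: (eqVneq (u.1 : nat) v.1) => h1; case: (eqVneq (u.2 : nat) v.2) => h2;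
case: (eqVneq (u.1 + u.2)%N (v.1 + v.2)%N) => h3;
case: (eqVneq (u.1%:Z - u.2%:Z) (v.1%:Z - v.2%:Z)) => h4 neq_uv;
  solve [exfalso; lia | rewrite /=; ring].
Qed.

Lemma row_sumE f v : row_sum f v = \sum_j f (v.1, j).
Proof.
rewrite /row_sum (eq_bigl (fun u => (u.1 == v.1) && true)); last first.
  by move=> u; rewrite andbT.
rewrite (eq_bigr (fun u => f (u.1, u.2))); last by case.
by rewrite -(pair_big (pred1 v.1) xpredT (fun i j => f (i, j))) big_pred1_eq.
Qed.

Lemma col_sumE f v : col_sum f v = \sum_i f (i, v.2).
Proof.
rewrite /col_sum (eq_bigr (fun u => f (u.1, u.2))); last by case.
rewrite -(pair_big xpredT (pred1 v.2) (fun i j => f (i, j))) /=.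
by apply: eq_bigr => i _; rewrite big_pred1_eq.
Qed.

(** * Differences of a row function and a column function *)

Definition row_col_diff (r : 'I_n -> R) v := r v.1 - r v.2.

Lemma row_col_diff_eigen (r : 'I_n -> R) v :
  (forall i, r (rev_ord i) = r i) ->
  \sum_u row_col_diff r u * (queens_adj u v)%:R =
  (n%:R - 4) * row_col_diff r v.
Proof.
move=> r_rev; rewrite sum_queens_adj.
have -> : diag_sum (row_col_diff r) v = 0.
  apply: (@sum_odd_involution _ _ _ _ (fun u => (rev_ord u.2, rev_ord u.1))).
  - by case=> i j; rewrite /= !rev_ordK.
  - by case=> i j /=; congr (_ == _); have := ltn_ord i; have := ltn_ord j; lia.
  - by case=> i j; rewrite /row_col_diff /= !r_rev opprB.
have -> : antidiag_sum (row_col_diff r) v = 0.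
  apply: (@sum_odd_involution _ _ _ _ (fun u => (u.2, u.1))).
  - by case.
  - by case=> i j /=; rewrite addnC.
  - by case=> i j; rewrite /row_col_diff /= opprB.
rewrite row_sumE col_sumE /row_col_diff /= !sumrB !sumr_const !card_ord.
by ring.
Qed.

(** * Main diagonal minus main antidiagonal *)

Definition diag_cross v : R := (v.2 == v.1)%:R - (v.2 == rev_ord v.1)%:R.

Lemma diag_cross_mirror u :
  diag_cross (u.1, rev_ord u.2) = - diag_cross u.
Proof.
case: u => i j; rewrite /diag_cross /= (inj_eq rev_ord_inj) opprB.
by rewrite (can2_eq rev_ordK rev_ordK).
Qed.

Lemma mirror_inv : involutive (fun u => (u.1, rev_ord u.2)).
Proof. by case=> i j; rewrite /= rev_ordK. Qed.

Lemma sum_graph (P : pred ('I_n * 'I_n)) (h : 'I_n -> 'I_n) :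
  \sum_(u | P u) (u.2 == h u.1)%:R = \sum_i (P (i, h i))%:R :> R.
Proof.
pose F i j : R := if P (i, j) then (j == h i)%:R else 0.
rewrite big_mkcond (eq_bigr (fun u => F u.1 u.2)); last by case.
rewrite -(pair_bigA _ F) /F /=.
apply: eq_bigr => i _; rewrite (bigD1 (h i)) //= eqxx big1 ?addr0.
  by case: (P _).
by move=> j /negbTE ->; case: (P _).
Qed.

(** An antidiagonal of even index meets the main diagonal exactly once, one of
    odd index misses it; among the antidiagonals, only the main one meets the
    main antidiagonal. *)
Lemma antidiag_sum_diag_cross v :
  antidiag_sum diag_cross v =
  (~~ odd (v.1 + v.2))%:R - n%:R * (v.2 == rev_ord v.1)%:R.
Proof.
case: v => p q; rewrite /antidiag_sum /diag_cross sumrB.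
rewrite (sum_graph _ id) (sum_graph _ (@rev_ord n)) /=; congr (_ - _).
  have lt_half : ((p + q)./2 < n)%N.
    by have := ltn_ord p; have := ltn_ord q; lia.
  rewrite (bigD1 (Ordinal lt_half)) //= big1 => [|i].
    by rewrite addr0; congr (nat_of_bool _)%:R; lia.
  by rewrite -val_eqE /= => i_neq; have -> : (i + i == p + q)%N = false by lia.
rewrite (eq_bigr (fun _ => (q == rev_ord p)%:R)) => [|i _].
  by rewrite sumr_const card_ord mulr_natl.
congr (nat_of_bool _)%:R; rewrite -val_eqE /=.
by have := ltn_ord p; have := ltn_ord q; have := ltn_ord i; lia.
Qed.

(** The reflection of the columns turns diagonals into antidiagonals. *)
Lemma diag_sum_diag_cross v :
  diag_sum diag_cross v = - antidiag_sum diag_cross (v.1, rev_ord v.2).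
Proof.
rewrite /diag_sum /antidiag_sum -sumrN [RHS](reindex_inj (inv_inj mirror_inv)).
apply: eq_big => u; last by rewrite diag_cross_mirror opprK.
by case: u v => [i j] [p q] /=; have := ltn_ord j; have := ltn_ord q; lia.
Qed.

(** Off the two main lines, the diagonal and the antidiagonal through a square
    contribute opposite amounts because, for odd [n], the indices [i + j] and
    [i + (n - 1 - j)] have the same parity. *)
Lemma diag_cross_eigen v :
  odd n ->
  \sum_u diag_cross u * (queens_adj u v)%:R = (n%:R - 4) * diag_cross v.
Proof.
move=> n_odd; rewrite sum_queens_adj.
have -> : row_sum diag_cross v = 0.
  exact: (sum_odd_involution mirror_inv _ diag_cross_mirror).
have -> : col_sum diag_cross v = 0.
  apply: (@sum_odd_involution _ _ _ _ (fun u => (rev_ord u.1, u.2))) => //.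
    by case=> i j; rewrite /= rev_ordK.
  by case=> i j; rewrite /diag_cross /= rev_ordK opprB.
rewrite diag_sum_diag_cross !antidiag_sum_diag_cross /= (inj_eq rev_ord_inj).
have -> : odd (v.1 + (n - v.2.+1)) = odd (v.1 + v.2).
  by have := ltn_ord v.2; lia.
by rewrite /diag_cross; ring.
Qed.

End Board.

(** * Independent eigenfunctions *)

Section Family.
Variables (R : realType) (n : nat).
Hypothesis n_gt0 : (0 < n)%N.

(** The reversal-invariant pairs [{t, n - 1 - t}] with [t < (n - 1)./2] are
    those that avoid the central row [(n - 1)./2] (the upper one of the two
    central rows, for even [n]). *)
Definition pair_ind (t : 'I_(n.-1)./2) (i : 'I_n) : R :=
  ((i == t :> nat) || (rev_ord i == t :> nat))%:R.

Lemma pair_ind_rev t i : pair_ind t (rev_ord i) = pair_ind t i.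
Proof. by rewrite /pair_ind rev_ordK orbC. Qed.

Lemma central_row_subproof : ((n.-1)./2 < n)%N.
Proof. by lia. Qed.
Definition central_row : 'I_n := Ordinal central_row_subproof.

Lemma upper_row_subproof (t : 'I_(n.-1)./2) : (t < n)%N.
Proof. by have := ltn_ord t; lia. Qed.
Definition upper_row (t : 'I_(n.-1)./2) : 'I_n :=
  Ordinal (upper_row_subproof t).

Lemma pair_ind_central t : pair_ind t central_row = 0.
Proof.
by rewrite /pair_ind /=; have := ltn_ord t; case: orP => //; lia.
Qed.

Lemma pair_ind_upper s t : pair_ind s (upper_row t) = (s == t)%:R.
Proof.
rewrite /pair_ind -val_eqE /=; congr (nat_of_bool _)%:R.
by have := ltn_ord s; have := ltn_ord t; lia.
Qed.

Lemma row_col_diff_dual s t :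
  row_col_diff (pair_ind s) (upper_row t, central_row) = (s == t)%:R.
Proof. by rewrite /row_col_diff /= pair_ind_upper pair_ind_central subr0. Qed.

Lemma queens_mult_ge :
  ((n.-1)./2 <= eigen_mult (adjacency_mx R (@queens_adj n)) (n%:R - 4))%N.
Proof.
rewrite -[leqLHS]card_ord.
apply: (eigen_mult_ge (f := fun t => row_col_diff (pair_ind t))
                      (p := fun t => (upper_row t, central_row))).
  by move=> t v; apply: row_col_diff_eigen; apply: pair_ind_rev.
exact: row_col_diff_dual.
Qed.

(** The corner square completes the dual system: antisymmetric functions
    vanish there, while [diag_cross] vanishes on the upper half of the central
    column. *)
Lemma queens_mult_ge_odd :
  odd n -> (1 < n)%N ->
  ((n.-1)./2.+1 <= eigen_mult (adjacency_mx R (@queens_adj n)) (n%:R - 4))%N.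
Proof.
move=> n_odd n_gt1; rewrite -[X in X.+1]card_ord -card_option.
pose corner : 'I_n * 'I_n := (Ordinal n_gt0, Ordinal n_gt0).
apply: (eigen_mult_ge
  (f := fun o => if o is Some t then row_col_diff (pair_ind t)
                 else @diag_cross R n)
  (p := fun o => if o is Some t then (upper_row t, central_row)
                 else corner)).
  move=> [t|] v; last exact: diag_cross_eigen.
  by apply: row_col_diff_eigen; apply: pair_ind_rev.
move=> [s|] [t|].
- exact: row_col_diff_dual.
- by rewrite /row_col_diff subrr.
- rewrite /diag_cross -!val_eqE /=; have := ltn_ord t => lt_t.
  have -> : ((n.-1)./2 == t) = false by lia.
  have -> : ((n.-1)./2 == n - t.+1)%N = false by lia.
  by rewrite subrr.
- rewrite /diag_cross -!val_eqE /=.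
  have -> : (0 == n - 1)%N = false by lia.
  by rewrite subr0.
Qed.

End Family.

Theorem corollary4p2 (R : realType) (n : nat) (hn : (3 <= n)%N) :
  let A : 'M[R]_#|{: 'I_n * 'I_n}| := adjacency_mx R (@queens_adj n) in
  (~~ odd n ->
     eigenvalue A (n%:R - 4) /\
     ((n - 2) %/ 2 <= eigen_mult A (n%:R - 4))%N) /\
  (odd n ->
     eigenvalue A (n%:R - 4) /\
     ((n + 1) %/ 2 <= eigen_mult A (n%:R - 4))%N).
Proof.
move=> A; have n_gt0 : (0 < n)%N by lia.
have multA := queens_mult_ge R n_gt0.
split=> n_par.
  split; last by apply: leq_trans multA; lia.
  by apply: eigen_mult_gt0; apply: leq_trans multA; lia.
have {}multA := queens_mult_ge_odd R n_gt0 n_par (ltnW hn).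
split; last by apply: leq_trans multA; lia.
by apply: eigen_mult_gt0; apply: leq_trans multA.
Qed.
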